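(* Let $L$ be a solvable finite-dimensional Lie algebra over a field $F$, and let $C/R = \bar{C}$ be the crown associated with a supplemented chief factor of $L$. Then $\bar{C}$ is complemented in $\bar{L} = L/R$, and any two complements of $\bar{C}$ in $\bar{L}$ are conjugate by an automorphism of $\bar{L}$ of the form $1 + \mathrm{ad}\,a$ for some $a \in \bar{C}$.
   Context: A chief factor of $L$ is $A/B$ with $B\subsetneq A$ ideals and no ideal strictly between; $C_L(A/B) = \{x : [x,A]\subseteq B\}$. A subalgebra $M$ supplements $A/B$ if $L=A+M$ and $B\subseteq A\cap M$; $A/B$ is supplemented if such $M$ exists. The core $M_L$ is the largest ideal of $L$ in $M$; $L$ is primitive if some maximal subalgebra has zero core; monolithic if it has a unique minimal ideal; primitive of type 3 if it has exactly two distinct minimal ideals, both non-abelian. Chief factors are $L$-connected if they are isomorphic as $L$-modules or there is an ideal $N$ with $L/N$ primitive of type 3 whose two minimal ideals are $L$-isomorphic to them respectively. The crown associated with a supplemented chief factor $A/B$ is $C/R$ with $C = A + C_L(A/B)$ and $R$ the intersection of all $M_L$, $M$ a maximal subalgebra with $L/M_L$ monolithic and primitive supplementing a chief factor $L$-connected to $A/B$. A subalgebra $K$ complements an ideal $I$ if $I + K$ is the whole algebra and $I \cap K = 0$.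
   Formalization: A supplemented chief factor is taken to be one supplemented by a maximal (equivalently, a proper) subalgebra, since allowing M = L would make every chief factor supplemented and the crown C/R could then be undefined. *)

(* Defs.v *)
(* finite-dimensional Lie algebras over a field F, modelled as
   a vectType F equipped with a bracket.  Quotients L/N are handled through the
   correspondence with subspaces of L containing N. *)
From HB Require Import structures.
From mathcomp Require Import all_boot all_order all_algebra.
Set Implicit Arguments. Unset Strict Implicit. Unset Printing Implicit Defensive.
Import GRing.Theory.
Local Open Scope ring_scope.

Section LieDefs.
Variables (F : fieldType) (L : vectType F) (br : L -> L -> L).

Definition lie_bracket : Prop :=
  [/\ forall (a : F) (x y z : L), br (a *: x + y) z = a *: br x z + br y z,
      forall (a : F) (x y z : L), br z (a *: x + y) = a *: br z x + br z y,
      forall x : L, br x x = 0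
    & forall x y z : L, br x (br y z) + br y (br z x) + br z (br x y) = 0].

Definition brv (U V : {vspace L}) : {vspace L} :=
  (\sum_(u <- vbasis U) \sum_(v <- vbasis V) <[br u v]>)%VS.

Definition derived (k : nat) : {vspace L} := iter k (fun U => brv U U) fullv.

Definition solvable_lie : Prop := exists k, derived k = 0%VS.

Definition subalg (M : {vspace L}) : Prop :=
  forall x y, x \in M -> y \in M -> br x y \in M.

Definition ideal (I : {vspace L}) : Prop :=
  forall x y, y \in I -> br x y \in I.

Definition chief_factor (A B : {vspace L}) : Prop :=
  [/\ ideal A, ideal B, (B <= A)%VS, B != A &
      forall N, ideal N -> (B <= N)%VS -> (N <= A)%VS -> N = B \/ N = A].

Definition in_cent_factor (A B : {vspace L}) (x : L) : Prop :=
  forall y, y \in A -> br x y \in B.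

Definition max_subalg (M : {vspace L}) : Prop :=
  [/\ subalg M, M != fullv &
      forall S, subalg S -> (M <= S)%VS -> S = M \/ S = fullv].

Definition supplements (M A B : {vspace L}) : Prop :=
  (A + M)%VS = fullv /\ (B <= A :&: M)%VS.

Definition supplemented (A B : {vspace L}) : Prop :=
  exists M, max_subalg M /\ supplements M A B.

Definition is_core (M K : {vspace L}) : Prop :=
  [/\ ideal K, (K <= M)%VS & forall I, ideal I -> (I <= M)%VS -> (I <= K)%VS].

Definition min_ideal_mod (N I : {vspace L}) : Prop := chief_factor I N.

Definition monolithic_mod (N : {vspace L}) : Prop :=
  exists I, min_ideal_mod N I /\ forall J, min_ideal_mod N J -> J = I.

(* L/N is primitive: some maximal subalgebra M/N of L/N has zero core *)
Definition primitive_mod (N : {vspace L}) : Prop :=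
  exists M, [/\ max_subalg M, (N <= M)%VS & is_core M N].

Definition nonabelian_mod (N I : {vspace L}) : Prop :=
  ~ (forall x y, x \in I -> y \in I -> br x y \in N).

Definition primitive3_mod (N I1 I2 : {vspace L}) : Prop :=
  [/\ primitive_mod N, I1 != I2, min_ideal_mod N I1 /\ min_ideal_mod N I2,
      forall J, min_ideal_mod N J -> J = I1 \/ J = I2 &
      nonabelian_mod N I1 /\ nonabelian_mod N I2].

(* A/B and A'/B' are isomorphic as L-modules, via (a lift of) a linear map f *)
Definition Liso (A B A' B' : {vspace L}) : Prop :=
  exists f : 'Hom(L, L),
    [/\ forall x, x \in A -> f x \in A',
        forall x, x \in A -> (f x \in B') = (x \in B),
        forall y, y \in A' -> exists2 x, x \in A & f x - y \in B'
      & forall z x, x \in A -> f (br z x) - br z (f x) \in B'].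

Definition Lconnected (A B A' B' : {vspace L}) : Prop :=
  Liso A B A' B' \/
  exists N I1 I2, [/\ ideal N, primitive3_mod N I1 I2,
                      Liso I1 N A B & Liso I2 N A' B'].

Definition crown (A B C R : {vspace L}) : Prop :=
  [/\ chief_factor A B, supplemented A B,
      (forall x, x \in C <->
         exists a c, [/\ a \in A, in_cent_factor A B c & x = a + c])
    & (forall x, x \in R <->
         forall M K, max_subalg M -> is_core M K ->
           monolithic_mod K -> primitive_mod K ->
           (exists A' B', [/\ chief_factor A' B', Lconnected A' B' A B &
                              supplements M A' B']) ->
           x \in K)].

Definition complement_mod (R C K : {vspace L}) : Prop :=
  [/\ subalg K, (R <= K)%VS, (K + C)%VS = fullv & (K :&: C)%VS = R].

Definition one_ad_aut_mod (R : {vspace L}) (a : L) : Prop :=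
  [/\ forall x, (x + br a x \in R) <-> (x \in R),
      forall y, exists x, (x + br a x) - y \in R
    & forall x y, br (x + br a x) (y + br a y) - (br x y + br a (br x y)) \in R].

Definition one_ad_maps_mod (R : {vspace L}) (a : L) (K1 K2 : {vspace L}) : Prop :=
  forall y, y \in K2 <-> exists2 x, x \in K1 & y - (x + br a x) \in R.

End LieDefs.

(* Main.v *)
(* Since L is solvable, A/B is abelian and C = C_L(A/B).  If M is one of the
   maximal subalgebras defining R and K is its core, then C/K is a chief factor
   isomorphic to A/B, K = C :&: M and [C, C] <= K; hence C/R is abelian.

   Existence: a minimal subalgebra S with R <= S and S + C = L is a complement,
   since S :&: C is an ideal, and if it were not contained in M then S :&: M
   would still supplement C.

   Conjugacy: if C != L, some ideal N >= C with [N, N] <= C contains b acting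
   injectively on A/B, hence injectively, so bijectively, on C/R.  A complement
   K1 contains an element b1 of b + C, and K1 = {x | [b1, [b1, x]] in R}.  For a
   second complement with b2, bijectivity gives a in C with
   (1 + ad a) b1 = b2 modulo R, and 1 + ad a carries the one description to the
   other. *)
Require Import Defs.
From HB Require Import structures.
From mathcomp Require Import all_boot all_order all_algebra.
From Stdlib Require Import Classical.

Set Implicit Arguments. Unset Strict Implicit. Unset Printing Implicit Defensive.
Import GRing.Theory.
Local Open Scope ring_scope.

(** * Extremal subspaces and dimension counts *)

Section Subspaces.
Context (F : fieldType) (L : vectType F).
Implicit Types U W : {vspace L}.

Lemma vspace_min_ex (P : {vspace L} -> Prop) :
  (exists U, P U) -> exists2 U, P U & forall W, P W -> (W <= U)%VS -> W = U.
Proof.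
case=> U; have [n] := ubnP (\dim U); elim: n U => // n IHn U leUn PU.
case: (classic (exists W, [/\ P W, (W <= U)%VS & W <> U])) => [[W [PW sWU neWU]]|noW].
  apply: (IHn W) => //; move: leUn; rewrite ltnS; apply: leq_trans.
  rewrite ltn_neqAle dimvS // andbT.
  by apply/eqP=> eqd; apply: neWU; apply/eqP; rewrite eqEdim sWU eqd leqnn.
by exists U => // W PW sWU; apply: NNPP => neWU; apply: noW; exists W.
Qed.

Lemma vspace_max_ex (P : {vspace L} -> Prop) :
  (exists U, P U) -> exists2 U, P U & forall W, P W -> (U <= W)%VS -> W = U.
Proof.
case=> U; have [n] := ubnP (\dim {:L} - \dim U); elim: n U => // n IHn U leUn PU.
case: (classic (exists W, [/\ P W, (U <= W)%VS & W <> U])) => [[W [PW sUW neWU]]|noW].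
  apply: (IHn W) => //; move: leUn; rewrite ltnS; apply: leq_trans.
  have ltd : (\dim U < \dim W)%N.
    rewrite ltn_neqAle dimvS // andbT; apply/eqP=> eqd; apply: neWU.
    by apply/esym/eqP; rewrite eqEdim sUW eqd leqnn.
  by apply: ltn_sub2l => //; apply: leq_trans ltd (dimvS (subvf W)).
by exists U => // W PW sWU; apply: NNPP => neWU; apply: noW; exists W.
Qed.

(** A maximal subspace inside [P] absorbs every line spanned by an element of [P]. *)
Lemma vspace_comprehension (P : L -> Prop) :
  P 0 -> (forall a x y, P x -> P y -> P (a *: x + y)) ->
  exists U, forall x, x \in U <-> P x.
Proof.
move=> P0 Plin.
have [|U PU maxU] := @vspace_max_ex (fun U => forall x, x \in U -> P x).
  by exists 0%VS => x; rewrite memv0 => /eqP->.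
exists U => x; split=> [/PU//|Px].
rewrite -(maxU (<[x]> + U)%VS) ?addvSr //.
  exact: (subvP (addvSl _ _)) (memv_line x).
by move=> _ /memv_addP[_ /vlineP[a ->] [u /PU Pu ->]]; apply: Plin.
Qed.

Lemma vspace_chain_stable (U : nat -> {vspace L}) :
  (forall k, (U k <= U k.+1)%VS) -> exists k, U k.+1 = U k.
Proof.
move=> incU; apply: NNPP => noU.
have dimU k : (k <= \dim (U k))%N.
  elim: k => // k IHk; apply: leq_ltn_trans IHk _.
  rewrite ltn_neqAle dimvS // andbT; apply/eqP=> eqd; apply: noU; exists k.
  by apply/esym/eqP; rewrite eqEdim incU eqd leqnn.
by have := leq_trans (dimU (\dim {:L}).+1) (dimvS (subvf _)); rewrite ltnn.
Qed.

(** Injectivity on [C / R] gives [f @: C :&: R = f @: R] and the same kernel of [f] on [C] and on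
    [R]; rank-nullity then turns it into surjectivity on [C / R]. *)
Lemma lfun_quo_surj (f : 'End(L)) (C R : {vspace L}) :
    (R <= C)%VS -> (f @: C <= C)%VS -> (f @: R <= R)%VS ->
    (forall x, x \in C -> f x \in R -> x \in R) ->
  (f @: C + R)%VS = C.
Proof.
move=> sRC fC fR injf; apply/eqP.
rewrite eqEdim subv_add fC sRC /=.
have capE : (f @: C :&: R = f @: R)%VS.
  apply/eqP; rewrite eqEsubv; apply/andP; split; last by rewrite subv_cap (limgS _ sRC).
  apply/subvP=> _ /memv_capP[/memv_imgP[x Cx ->] Rfx].
  exact: memv_img (injf _ Cx Rfx).
have kerE : (C :&: lker f = R :&: lker f)%VS.
  apply/eqP; rewrite eqEsubv (capvS sRC) ?subvv // andbT; apply/subvP=> x.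
  rewrite !memv_cap memv_ker => /andP[Cx fx0]; rewrite fx0 andbT.
  by apply: injf; rewrite ?(eqP fx0) ?mem0v.
have := dimv_sum_cap (f @: C) R; rewrite capE => dimE.
rewrite -(leq_add2r (\dim (f @: R))) dimE.
by rewrite -(limg_ker_dim f C) -(limg_ker_dim f R) kerE addnCA addnA.
Qed.

End Subspaces.

(** * Bracket calculus, ideals, cores, derived series *)

Section LieAlgebra.
Context (F : fieldType) (L : vectType F) (br : L -> L -> L) (Hbr : lie_bracket br).
Implicit Types (x y z : L) (A B C I J M N R U V W : {vspace L}).

Lemma brDl x y z : br (x + y) z = br x z + br y z.
Proof. by case: Hbr => H _ _ _; have := H 1 x y z; rewrite !scale1r. Qed.

Lemma brDr x y z : br z (x + y) = br z x + br z y.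
Proof. by case: Hbr => _ H _ _; have := H 1 x y z; rewrite !scale1r. Qed.

Lemma br0l z : br 0 z = 0.
Proof. by apply: (addrI (br 0 z)); rewrite -brDl !addr0. Qed.

Lemma br0r z : br z 0 = 0.
Proof. by apply: (addrI (br z 0)); rewrite -brDr !addr0. Qed.

Lemma brZr a x z : br z (a *: x) = a *: br z x.
Proof. by case: Hbr => _ H _ _; have := H a x 0 z; rewrite br0r !addr0. Qed.

Lemma brZl a x z : br (a *: x) z = a *: br x z.
Proof. by case: Hbr => H _ _ _; have := H a x 0 z; rewrite br0l !addr0. Qed.

Lemma brNl x z : br (- x) z = - br x z.
Proof. by rewrite -scaleN1r brZl scaleN1r. Qed.

Lemma brNr x z : br z (- x) = - br z x.
Proof. by rewrite -scaleN1r brZr scaleN1r. Qed.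

Lemma brC x y : br x y = - br y x.
Proof.
case: Hbr => _ _ brxx _; apply/eqP; rewrite -addr_eq0; apply/eqP.
by have := brxx (x + y); rewrite brDl !brDr !brxx addr0 add0r.
Qed.

Lemma br_jacobi x y z : br x (br y z) = br (br x y) z + br y (br x z).
Proof.
case: Hbr => _ _ _ /(_ x y z) H; apply/eqP; rewrite -subr_eq0 -[X in _ == X]H.
by rewrite (brC z (br x y)) (brC z x) brNr opprD addrA addrAC.
Qed.

Lemma ad_lfun_ex x : exists f : 'End(L), f =1 br x.
Proof.
have linx : linear (br x) by case: Hbr => _ H _ _ a u v; apply: H.
pose f : {linear L -> L} := HB.pack (br x) (GRing.isLinear.Build _ _ _ _ (br x) linx).
by exists (linfun f) => u; rewrite lfunE.
Qed.

Lemma ideal_br I x y : ideal br I -> y \in I -> br y x \in I.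
Proof. by move=> idI Iy; rewrite brC rpredN; apply: idI. Qed.

Lemma ideal_add I J : ideal br I -> ideal br J -> ideal br (I + J)%VS.
Proof.
move=> idI idJ x _ /memv_addP[u Iu [v Jv ->]].
by rewrite brDr memv_add ?idI ?idJ.
Qed.

Lemma ideal_cap I J : ideal br I -> ideal br J -> ideal br (I :&: J)%VS.
Proof.
by move=> idI idJ x y; rewrite !memv_cap => /andP[Iy Jy]; rewrite idI ?idJ.
Qed.

Lemma subalg_add_ideal M I : subalg br M -> ideal br I -> subalg br (M + I)%VS.
Proof.
move=> saM idI _ _ /memv_addP[u Mu [v Iv ->]] /memv_addP[u' Mu' [v' Iv' ->]].
rewrite brDr (brDl u v u') -addrA memv_add ?saM //.
exact: rpredD (ideal_br _ idI Iv) (idI _ _ Iv').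
Qed.

Lemma core_ex M : exists K, is_core br M K.
Proof.
have [|K [idK sKM] maxK] :=
    @vspace_max_ex F L (fun I => ideal br I /\ (I <= M)%VS).
  by exists 0%VS; split; rewrite ?sub0v // => x y; rewrite !memv0 => /eqP->; rewrite br0r.
exists K; split=> // I idI sIM.
have <- : (I + K = K)%VS.
  by apply: maxK; rewrite ?addvSr // subv_add sIM sKM; split=> //; apply: ideal_add.
exact: addvSl.
Qed.

Lemma mem_brv U V x y : x \in U -> y \in V -> br x y \in brv br U V.
Proof.
move=> Ux Vy.
have basis_br u : u \in vbasis U -> br u y \in brv br U V.
  move=> Uu; have [f fE] := ad_lfun_ex u.
  rewrite -fE (coord_vbasis Vy) linear_sum rpred_sum // => j _.
  rewrite linearZ rpredZ //= fE /brv (big_rem u) //=; apply: (subvP (addvSl _ _)).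
  rewrite (big_rem (vbasis V)`_j) ?mem_nth ?size_tuple //=.
  by rewrite (subvP (addvSl _ _)) ?memv_line.
have [f fE] := ad_lfun_ex y.
rewrite brC rpredN -fE (coord_vbasis Ux) linear_sum rpred_sum // => i _.
by rewrite linearZ rpredZ //= fE brC rpredN basis_br // mem_nth ?size_tuple.
Qed.

Lemma brv_sub U V W :
  (forall x y, x \in U -> y \in V -> br x y \in W) -> (brv br U V <= W)%VS.
Proof.
move=> brW; rewrite /brv big_seq.
apply: (big_ind (fun S => (S <= W)%VS)) => [||u Uu]; rewrite ?sub0v //.
  by move=> S T sSW sTW; rewrite subv_add sSW.
rewrite big_seq.
apply: (big_ind (fun S => (S <= W)%VS)) => [||v Vv]; rewrite ?sub0v //.
  by move=> S T sSW sTW; rewrite subv_add sSW.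
by rewrite -memvE brW ?vbasis_mem.
Qed.

Lemma ideal_brv I : ideal br I -> ideal br (brv br I I).
Proof.
move=> idI z w; have [f fE] := ad_lfun_ex z.
suffices /subvP sub : (brv br I I <= f @^-1: brv br I I)%VS.
  by move/sub; rewrite -memv_preim fE.
apply: brv_sub => x y Ix Iy; rewrite -memv_preim fE br_jacobi.
by rewrite rpredD ?mem_brv ?idI.
Qed.

Lemma ideal_derived k : ideal br (derived br k).
Proof. by elim: k => [|k IHk] x y; rewrite ?memvf //; apply: ideal_brv. Qed.

(** * Chief factors of a solvable algebra *)

Section Solvable.
Hypothesis Hsolv : solvable_lie br.

Lemma chief_abelian A B :
  chief_factor br A B -> forall x y, x \in A -> y \in A -> br x y \in B.
Proof.
move=> [idA idB sBA neBA minA] x y Ax Ay.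
have idI : ideal br (brv br A A + B)%VS by apply: ideal_add => //; apply: ideal_brv.
have sIA : (brv br A A + B <= A)%VS.
  by rewrite subv_add sBA andbT; apply: brv_sub => u v _; apply: idA.
have [<- | perfA] := minA _ idI (addvSr _ _) sIA.
  by rewrite (subvP (addvSl _ _)) ?mem_brv.
have [k Dk0] := Hsolv; case/eqP: neBA; apply/eqP; rewrite eqEsubv sBA /=.
(* If [A / B] were perfect, it would lie in the image of every derived term, and term [k] is
   zero. *)
suffices: (A <= derived br k + B)%VS by rewrite Dk0 add0v.
elim: k {Dk0} => [|k IHk]; first exact: subv_trans (subvf _) (addvSl _ _).
rewrite -{1}perfA subv_add addvSr andbT; apply: brv_sub => u v Au Av.
have /memv_addP[d Dd [b Bb ->]] := subvP IHk u Au.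
have /memv_addP[d' Dd' [b' Bb' ->]] := subvP IHk v Av.
rewrite brDr (brDl d b d') -addrA memv_add ?mem_brv //.
exact: rpredD (ideal_br _ idB Bb) (idB _ _ Bb').
Qed.

(** Connection through a type 3 quotient requires a non-abelian chief factor, which solvability
    excludes. *)
Lemma Lconnected_Liso A B A' B' : Lconnected br A B A' B' -> Liso br A B A' B'.
Proof.
case=> // -[N [I1 [I2 [_ [_ _ [chI1 _] _ [nab _]] _ _]]]].
by case: nab; apply: chief_abelian.
Qed.

End Solvable.

(** * Transfer along module isomorphisms *)

Definition injective_on_factor A B b : Prop :=
  forall x, x \in A -> br b x \in B -> x \in B.

(** Isomorphic modules have the same annihilator: [f] commutes with [ad x] modulo [B']. *)
Lemma Liso_cent A B A' B' x :
    ideal br A -> ideal br B' -> Liso br A B A' B' ->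
  in_cent_factor br A' B' x <-> in_cent_factor br A B x.
Proof.
move=> idA idB' [f [fA fB fsurj fbr]]; split=> cx y Ay.
  rewrite -fB ?idA // -(subrK (br x (f y)) (f _)) rpredD ?fbr //.
  exact: cx (fA _ Ay).
have [z Az Bzy] := fsurj y Ay.
rewrite -(subKr (f z) y) brDr brNr rpredB ?(idB' _ _ Bzy) //.
by rewrite -(subKr (f (br x z)) (br x (f z))) rpredB ?fbr // fB ?cx ?idA.
Qed.

Lemma Liso_injective A B A' B' b :
    ideal br A -> Liso br A B A' B' -> injective_on_factor A' B' b ->
  injective_on_factor A B b.
Proof.
move=> idA [f [fA fB _ fbr]] injb x Ax Bbx; rewrite -fB //; apply: injb; first exact: fA.
by rewrite -(subKr (f (br b x)) (br b (f x))) rpredB ?fbr // fB ?idA.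
Qed.

(** * Elements acting injectively on a chief factor *)

Section Centralizer.
Context (A B C : {vspace L}).
Hypothesis chAB : chief_factor br A B.
Hypothesis centC : forall x, x \in C <-> in_cent_factor br A B x.

Lemma ideal_cent : ideal br C.
Proof.
have [idA idB _ _ _] := chAB.
move=> x c /centC cc; apply/centC => y Ay.
have -> : br (br x c) y = br x (br c y) - br c (br x y) by rewrite (br_jacobi x c) addrK.
by apply: rpredB; [apply: idB|]; rewrite cc ?idA.
Qed.

(* For [b] in [N] the Fitting null component of [ad b] on [A / B] is an ideal,
   because [N] acts on [A / B] through an abelian algebra; by irreducibility
   [ad b] is therefore either injective or nilpotent on [A / B].  If it were
   nilpotent for all [b], then [N] would kill a minimal [N]-submodule of
   [A / B], hence all of [A / B]. *)
Lemma injective_on_chief_factor N :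
    ideal br N -> (forall x y, x \in N -> y \in N -> br x y \in C) ->
  ~ (N <= C)%VS -> exists2 b, b \in N & injective_on_factor A B b.
Proof.
have [idA idB sBA neBA minA] := chAB.
move=> idN abN nNC.
pose stable W := [/\ (B <= W)%VS, (W <= A)%VS, W <> B &
  forall n w, n \in N -> w \in W -> br n w \in W].
have [|W [sBW sWA neWB stW] minW] := @vspace_min_ex F L stable.
  exists A; split=> //; first by move=> eAB; rewrite eAB eqxx in neBA.
  by move=> n w _; apply: idA.
have commN n m v : n \in N -> m \in N -> v \in A -> br (br n m) v \in B.
  by move=> Nn Nm Av; apply: (proj1 (centC _)) => //; apply: abN.
have [b Nb injW] : exists2 b, b \in N & injective_on_factor W B b.
  apply: NNPP => noinj.
  have killW b w : b \in N -> w \in W -> br b w \in B.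
    move=> Nb Ww; have [f fE] := ad_lfun_ex b.
    (* The kernel of [ad b] on [W / B] is [N]-stable since [[N, N]] kills [A / B], and nonzero by
       [noinj]; minimality makes it all of [W / B]. *)
    suffices eqW : (W :&: f @^-1: B)%VS = W.
      by move: Ww; rewrite -eqW memv_cap -memv_preim fE => /andP[].
    apply: minW; last exact: capvSl.
    split.
    - rewrite subv_cap sBW /=; apply/subvP=> x Bx; rewrite -memv_preim fE.
      exact: idB.
    - exact: subv_trans (capvSl _ _) sWA.
    - move=> eqB; apply: noinj; exists b => // x Wx Bbx.
      by rewrite -eqB memv_cap Wx -memv_preim fE.
    move=> n x Nn /memv_capP[Wx]; rewrite -memv_preim fE => Bbx.
    rewrite memv_cap stW // -memv_preim fE br_jacobi rpredD ?(idB _ _ Bbx) //.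
    by rewrite commN // (subvP sWA).
  (* [Z / B] is the part of [A / B] killed by [N], so [Z] is an ideal. It contains [W], hence is not
     [B]; being [A] would put [N] inside [C]. *)
  have [||Z ZE] := @vspace_comprehension F L
      (fun v => v \in A /\ forall n, n \in N -> br n v \in B).
  - by split=> [|n _]; rewrite ?br0r mem0v.
  - move=> a x y [Ax Zx] [Ay Zy]; split=> [|n Nn]; first by rewrite rpredD ?rpredZ.
    by rewrite brDr brZr rpredD ?rpredZ ?Zx ?Zy.
  have [|||ZB|ZA] := minA Z.
  - move=> x z /ZE[Az Zz]; apply/ZE; split=> [|n Nn]; first exact: idA.
    rewrite br_jacobi rpredD //; first by rewrite Zz // ideal_br.
    by rewrite idB ?Zz.
  - by apply/subvP=> x Bx; apply/ZE; split=> [|n _]; [apply: (subvP sBA) | apply: idB].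
  - by apply/subvP=> x /ZE[].
  - case: neWB; apply/eqP; rewrite eqEsubv sBW andbT -{1}ZB; apply/subvP=> w Ww.
    by apply/ZE; split=> [|n Nn]; [apply: (subvP sWA) | apply: killW].
  by case: nNC; apply/subvP=> n Nn; apply/centC => y; rewrite -ZA => /ZE[_ ->].
exists b => //; have [f fE] := ad_lfun_ex b.
(* [U k / B] is the kernel of the [k]-th power of [ad b] on [A / B]; the stable term is the Fitting
   null component. *)
pose U k := iter k (fun V => A :&: f @^-1: V)%VS B.
have US k v : (v \in U k.+1) = (v \in A) && (br b v \in U k).
  by rewrite /= memv_cap -memv_preim fE.
have incU k : (U k <= U k.+1)%VS.
  elim: k => [|k IHk]; apply/subvP=> v; rewrite !US.
    by move=> Bv; rewrite (subvP sBA) ?idB.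
  by case/andP=> -> /(subvP IHk); rewrite US.
have sBU k : (B <= U k)%VS.
  by elim: k => // k IHk; apply: subv_trans (incU k).
have NU k n v : n \in N -> v \in U k -> br n v \in U k.
  move=> Nn; elim: k v => [|k IHk] v; first exact: idB.
  rewrite !US => /andP[Av Ubv]; rewrite idA // br_jacobi rpredD ?(IHk _ Ubv) //.
  by rewrite (subvP (sBU k)) ?commN.
(* An arbitrary [x] raises the index by at most one, because [br b x] lies in [N] and [N] preserves
   each [U k]; so the stable term is an ideal. *)
have LU k x v : v \in U k -> br x v \in U k.+1.
  elim: k v => [|k IHk] v; first by move=> Bv; rewrite (subvP (incU 0)) ?idB.
  rewrite US [_ \in U k.+2]US => /andP[Av Ubv]; rewrite idA // br_jacobi.
  rewrite rpredD ?(IHk _ Ubv) // NU ?ideal_br //.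
  by rewrite US Av.
have [k Uk] := vspace_chain_stable incU.
have sUA : (U k <= A)%VS by rewrite -Uk capvSl.
have [|UB|UA] := minA (U k) _ (sBU k) sUA.
- by move=> x v Uv; rewrite -Uk; apply: LU.
- by move=> x Ax Bbx; rewrite -UB -Uk US Ax UB.
case: neWB; apply/eqP; rewrite eqEsubv sBW andbT; apply/subvP=> w Ww.
have: w \in U k by rewrite UA (subvP sWA).
elim: (k) w Ww => // j IHj w Ww; rewrite US => /andP[_ Ubw].
by apply: injW => //; apply: IHj => //; apply: stW.
Qed.

End Centralizer.

Lemma max_subalg_add_ideal M I :
  max_subalg br M -> ideal br I -> ~ (I <= M)%VS -> (M + I)%VS = fullv.
Proof.
move=> [saM _ maxM] idI nIM.
have [] // := maxM _ (subalg_add_ideal saM idI) (addvSl _ _).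
by move=> eqM; case: nIM; rewrite -eqM addvSr.
Qed.

(** * An abelian chief factor, its supplement and the core *)

Section Supplement.
Context (A B C M K : {vspace L}).
Hypothesis chAB : chief_factor br A B.
Hypothesis abA : forall x y, x \in A -> y \in A -> br x y \in B.
Hypothesis centC : forall x, x \in C <-> in_cent_factor br A B x.
Hypotheses (maxM : max_subalg br M) (suppM : supplements M A B).
Hypothesis coreK : is_core br M K.

Lemma chief_sub_cent : (A <= C)%VS.
Proof. by apply/subvP=> x Ax; apply/centC => y; apply: abA. Qed.

Lemma supplement_not_sub : ~ (A <= M)%VS.
Proof.
have [_ neM _] := maxM; have [AM _] := suppM.
by move=> /addv_idPr eqM; rewrite -AM eqM eqxx in neM.
Qed.

(** [A :&: M] is an ideal: [A] moves it into [B] because [A / B] is abelian, [M] preserves it, and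
    [A + M] is everything. It is not [A]. *)
Lemma supplement_cap : (A :&: M)%VS = B.
Proof.
have [idA idB _ _ minA] := chAB; have [saM _ _] := maxM; have [AM sBAM] := suppM.
have [|||//|eqA] := minA (A :&: M)%VS => //; last 2 first.
- exact: capvSl.
- by case: supplement_not_sub; rewrite -eqA capvSr.
move=> x z /memv_capP[Az Mz]; rewrite memv_cap idA //=.
have /memv_addP[a Aa [m Mm ->]] : x \in (A + M)%VS by rewrite AM memvf.
rewrite brDl rpredD ?(saM _ _ Mm) // (subvP (subv_trans sBAM (capvSr _ _))) //.
exact: abA.
Qed.

(** [C :&: M] is an ideal because [A] moves [C] into [B] and [M] is a subalgebra. Conversely [K]
    moves [A] into [A :&: M = B]. *)
Lemma cent_cap : (C :&: M)%VS = K.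
Proof.
have [idA idB _ _ _] := chAB; have [saM _ _] := maxM; have [AM sBAM] := suppM.
have [idK sKM maxK] := coreK; have idC := ideal_cent chAB centC.
apply/eqP; rewrite eqEsubv subv_cap sKM andbT; apply/andP; split; last first.
  apply/subvP=> k Kk; apply/centC => y Ay.
  by rewrite -supplement_cap memv_cap idA // (subvP sKM) // ideal_br.
apply: maxK; last exact: capvSr.
move=> x z /memv_capP[Cz Mz]; rewrite memv_cap idC //=.
have /memv_addP[a Aa [m Mm ->]] : x \in (A + M)%VS by rewrite AM memvf.
rewrite brDl rpredD ?(saM _ _ Mm) // (subvP (subv_trans sBAM (capvSr _ _))) //.
by rewrite brC rpredN; apply: (proj1 (centC z)).
Qed.

Lemma core_sub_cent : (K <= C)%VS.
Proof. by rewrite -cent_cap capvSl. Qed.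

Lemma chief_bottom_sub_core : (B <= K)%VS.
Proof. by rewrite -cent_cap -supplement_cap capvS ?chief_sub_cent. Qed.

Lemma chief_cap_core : (A :&: K)%VS = B.
Proof. by rewrite -cent_cap capvA (capv_idPl chief_sub_cent) supplement_cap. Qed.

Lemma cent_decomp : (A + K)%VS = C.
Proof.
have [AM _] := suppM.
apply/eqP; rewrite eqEsubv subv_add chief_sub_cent core_sub_cent; apply/subvP=> c Cc.
have /memv_addP[a Aa [m Mm eqc]] : c \in (A + M)%VS by rewrite AM memvf.
rewrite eqc memv_add // -cent_cap memv_cap Mm andbT.
have -> : m = c - a by rewrite eqc addrC addKr.
by rewrite rpredB // (subvP chief_sub_cent).
Qed.

Lemma cent_abelian_mod_core x y : x \in C -> y \in C -> br x y \in K.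
Proof.
move=> Cx; rewrite -cent_decomp => /memv_addP[a Aa [k Kk ->]].
have [idK _ _] := coreK.
rewrite brDr rpredD ?(idK _ _ Kk) // (subvP chief_bottom_sub_core) //.
exact: (proj1 (centC x)).
Qed.

(** [C = A + K] and [A :&: K = B] identify [C / K] with [A / B]. *)
Lemma injective_mod_core b : injective_on_factor A B b -> injective_on_factor C K b.
Proof.
have [idA _ _ _ _] := chAB; have [idK _ _] := coreK.
move=> injb x; rewrite -{1}cent_decomp => /memv_addP[a Aa [k Kk ->]].
rewrite brDr rpredDr ?(idK _ _ Kk) // => Kba; rewrite rpredD //.
apply: (subvP chief_bottom_sub_core); apply: injb => //.
by rewrite -chief_cap_core memv_cap idA.
Qed.

(** An ideal [J] between [K] and [C] either lies in [C :&: M = K], or satisfies [M + J = L], and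
    then [C = (C :&: M) + J = J]. *)
Lemma cent_chief_mod_core : chief_factor br C K.
Proof.
have [idK _ _] := coreK; have idC := ideal_cent chAB centC.
split=> //; first exact: core_sub_cent.
  apply/eqP=> eqKC; apply: supplement_not_sub.
  by apply: subv_trans chief_sub_cent _; rewrite -eqKC -cent_cap capvSr.
move=> J idJ sKJ sJC; case: (classic (J <= M)%VS) => sJM.
  by left; apply/eqP; rewrite eqEsubv sKJ andbT -cent_cap subv_cap sJC.
right; apply/eqP; rewrite eqEsubv sJC; apply/subvP=> c Cc.
have: c \in (M + J)%VS by rewrite (max_subalg_add_ideal maxM) ?memvf.
case/memv_addP=> m Mm [j Jj eqc]; rewrite eqc rpredD // (subvP sKJ) //.
rewrite -cent_cap memv_cap Mm andbT.
have -> : m = c - j by rewrite eqc addrK.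
by rewrite rpredB // (subvP sJC).
Qed.

(** A minimal ideal [J / K] meeting [C / K] trivially would move [A] into [A :&: K = B], so it would
    lie in [C] after all. *)
Lemma core_monolithic : monolithic_mod br K.
Proof.
have [idA _ _ _ _] := chAB; have [idK sKM maxK] := coreK.
have idC := ideal_cent chAB centC.
have [_ _ _ _ minC] := cent_chief_mod_core.
exists C; split=> [|J [idJ _ sKJ neKJ minJ]]; first exact: cent_chief_mod_core.
have sJC : (J <= C)%VS.
  have [|||eqK|<-] := minJ (J :&: C)%VS; last exact: capvSr.
  - exact: ideal_cap.
  - by rewrite subv_cap sKJ core_sub_cent.
  - exact: capvSl.
  apply/subvP=> j Jj; apply/centC => y Ay.
  rewrite -chief_cap_core memv_cap idA //= -eqK memv_cap ideal_br //=.
  by apply: idC; apply: (subvP chief_sub_cent).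
by have [] := minC J idJ sKJ sJC => // eqK; rewrite eqK eqxx in neKJ.
Qed.

End Supplement.

(** * The crown and the existence of complements *)

Section Crown.
Hypothesis Hsolv : solvable_lie br.
Context (A B C R : {vspace L}).
Hypothesis crownCR : crown br A B C R.

Lemma crown_cent x : x \in C <-> in_cent_factor br A B x.
Proof.
have [chAB _ CE _] := crownCR; have [_ idB _ _ _] := chAB.
split=> [/CE[a [c [Aa cc ->]]] y Ay|cx].
  by rewrite brDl rpredD ?cc // (chief_abelian Hsolv chAB).
by apply/CE; exists 0, x; rewrite mem0v add0r.
Qed.

Definition crown_core M K : Prop :=
  [/\ max_subalg br M, is_core br M K & exists A' B',
      [/\ chief_factor br A' B', Liso br A' B' A B & supplements M A' B']].

Lemma crown_core_cent A' B' : chief_factor br A' B' -> Liso br A' B' A B ->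
  forall x, x \in C <-> in_cent_factor br A' B' x.
Proof.
have [[_ idB _ _ _] _ _ _] := crownCR.
move=> [idA' _ _ _ _] isoA x; rewrite crown_cent; exact: Liso_cent.
Qed.

(** Connectedness is isomorphism by solvability, monolithicity comes from [core_monolithic], and [M]
    itself witnesses primitivity. *)
Lemma mem_crown_bottom x : x \in R <-> forall M K, crown_core M K -> x \in K.
Proof.
have [_ _ _ RE] := crownCR; rewrite RE; split=> Rx M K.
  move=> [maxM coreK [A' [B' [ch' iso' supp']]]]; apply: (Rx M) => //.
  - apply: (core_monolithic ch' (chief_abelian Hsolv ch') _ maxM supp' coreK).
    exact: crown_core_cent.
  - by exists M; split=> //; case: coreK.
  by exists A', B'; split=> //; left.
move=> maxM coreK _ _ [A' [B' [ch' con' supp']]]; apply: (Rx M); split=> //.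
by exists A', B'; split=> //; apply: Lconnected_Liso.
Qed.

(** The intersection giving [R] is thus over a nonempty family, which is what places [R] inside
    [C]. *)
Lemma crown_core_ex : exists M K, crown_core M K.
Proof.
have [chAB [M [maxM suppM]] _ _] := crownCR; have [K coreK] := core_ex M.
exists M, K; split=> //; exists A, B; split=> //.
exists \1%VF; split=> [x Ax|x _|y Ay|z x _]; rewrite ?id_lfunE ?subrr ?mem0v //.
by exists y; rewrite // id_lfunE subrr mem0v.
Qed.

Lemma ideal_crown_top : ideal br C.
Proof. by have [chAB _ _ _] := crownCR; apply: ideal_cent chAB crown_cent. Qed.

Lemma ideal_crown_bottom : ideal br R.
Proof.
move=> x y Ry; apply/mem_crown_bottom => M K MK.
have [_ [idK _ _] _] := MK.
by apply: idK; apply: (proj1 (mem_crown_bottom y) Ry) MK.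
Qed.

Lemma crown_sub : (R <= C)%VS.
Proof.
have [M [K MK]] := crown_core_ex; apply/subvP=> x Rx.
have Kx := proj1 (mem_crown_bottom x) Rx _ _ MK.
have [maxM coreK [A' [B' [ch' iso' supp']]]] := MK.
by apply: (subvP (core_sub_cent ch' (chief_abelian Hsolv ch')
  (crown_core_cent ch' iso') maxM supp' coreK)).
Qed.

Lemma crown_abelian x y : x \in C -> y \in C -> br x y \in R.
Proof.
move=> Cx Cy; apply/mem_crown_bottom => M K [maxM coreK [A' [B' [ch' iso' supp']]]].
exact: (cent_abelian_mod_core ch' (chief_abelian Hsolv ch')
  (crown_core_cent ch' iso') maxM supp' coreK).
Qed.

Lemma crown_injective b : injective_on_factor A B b -> injective_on_factor C R b.
Proof.
move=> injb x Cx /mem_crown_bottom Rbx; apply/mem_crown_bottom => M K MK.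
have [maxM coreK [A' [B' [ch' iso' supp']]]] := MK.
have [idA' _ _ _ _] := ch'.
apply: (injective_mod_core ch' (chief_abelian Hsolv ch')
  (crown_core_cent ch' iso') maxM supp' coreK (b := b)) => //.
  exact: Liso_injective iso' injb.
exact: Rbx MK.
Qed.

Lemma crown_complement_ex : exists K, complement_mod br R C K.
Proof.
have idC := ideal_crown_top; have idR := ideal_crown_bottom.
have [|S [saS sRS SC] minS] := @vspace_min_ex F L (fun S =>
    [/\ subalg br S, (R <= S)%VS & (S + C)%VS = fullv]).
  exists fullv; split; first by move=> x y; rewrite !memvf.
    exact: subvf.
  by apply/addv_idPl; apply: subvf.
exists S; split=> //; apply/eqP; rewrite eqEsubv.
apply/andP; split; last by rewrite subv_cap sRS crown_sub.
(* [S] preserves [S :&: C], and [C] moves it into [R], which lies in [S]. *)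
have idSC : ideal br (S :&: C)%VS.
  move=> x z /memv_capP[Sz Cz]; rewrite memv_cap idC // andbT.
  have /memv_addP[s Ss [c Cc ->]] : x \in (S + C)%VS by rewrite SC memvf.
  by rewrite brDl rpredD ?(saS _ _ Ss Sz) // (subvP sRS) ?crown_abelian.
apply/subvP=> x SCx; apply/mem_crown_bottom => M K MK.
have [maxM coreK [A' [B' [ch' iso' supp']]]] := MK.
have [saM _ _] := maxM.
have capC := cent_cap ch' (chief_abelian Hsolv ch')
  (crown_core_cent ch' iso') maxM supp' coreK.
suffices sSCM : (S :&: C <= M)%VS.
  by rewrite -capC memv_cap (subvP sSCM) // (subvP (capvSr S C)).
case: (classic (S :&: C <= M)%VS) => // nsub.
have MSC := max_subalg_add_ideal maxM idSC nsub.
suffices <- : (S :&: M)%VS = S by apply: subv_trans (capvSl _ _) (capvSr _ _).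
apply: minS; last exact: capvSl.
split.
- by move=> u v; rewrite !memv_cap => /andP[Su Mu] /andP[Sv Mv]; rewrite saS ?saM.
- rewrite subv_cap sRS; apply/subvP=> u Ru.
  have : u \in K by apply: (proj1 (mem_crown_bottom u) Ru) MK.
  by rewrite -capC => /memv_capP[].
apply/eqP; rewrite eqEsubv subvf; apply/subvP=> u _.
have /memv_addP[s Ss [c Cc ->]] : u \in (S + C)%VS by rewrite SC memvf.
(* Then [m = s - r] lies in [S :&: M], and [r] is absorbed by [C]. *)
have /memv_addP[m Mm [r /memv_capP[Sr Cr] eqs]] : s \in (M + (S :&: C))%VS.
  by rewrite MSC memvf.
rewrite eqs -addrA memv_add ?(rpredD Cr) // memv_cap Mm andbT.
have -> : m = s - r by rewrite eqs addrK.
by rewrite rpredB.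
Qed.

(** * The maps [1 + ad a] and conjugacy of complements *)

Lemma one_ad_br a x y : a \in C ->
  br (x + br a x) (y + br a y) - (br x y + br a (br x y)) \in R.
Proof.
move=> Ca; rewrite (br_jacobi a x y) brDl !brDr.
have cancel u v w t : u + v + (w + t) - (u + (w + v)) = t :> L.
  by rewrite (addrC w v) !addrA [LHS]addrC addKr.
(* What remains is [[[a, x], [a, y]]], an element of [[C, C]]. *)
by rewrite cancel crown_abelian // ideal_br //; apply: ideal_crown_top.
Qed.

Lemma one_ad_aut a : a \in C -> one_ad_aut_mod br R a.
Proof.
move=> Ca; have idC := ideal_crown_top; have idR := ideal_crown_bottom.
split=> [x|y|x y]; last exact: one_ad_br.
  split=> [Rx|Rx]; last by rewrite rpredD ?idR.
  have Cx : x \in C.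
    by rewrite -(rpredDr _ (ideal_br x idC Ca)) (subvP crown_sub).
  by move: Rx; rewrite rpredDr ?crown_abelian.
(* The inverse modulo [R] is [1 - ad a], since the square of [ad a] maps into [[C, C]]. *)
exists (y - br a y); rewrite brDr brNr.
have -> : y - br a y + (br a y - br a (br a y)) - y = - br a (br a y).
  by rewrite addrA subrK [LHS]addrC addKr.
by rewrite rpredN crown_abelian // ideal_br.
Qed.

(* If [b] lies in [K], the bracket [br b x] lies in [N :&: K] for [x] in [K],
   so [(ad b)^2] maps [K] into [C :&: K]; injectivity of [ad b] on [C / R]
   gives the converse. *)
Lemma mem_crown_complement N K b x :
    ideal br N -> (forall y z, y \in N -> z \in N -> br y z \in C) ->
    b \in N -> injective_on_factor C R b ->
    complement_mod br R C K -> b \in K ->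
  x \in K <-> br b (br b x) \in R.
Proof.
move=> idN abN Nb injb [saK sRK KC KcapC] Kb.
have idC := ideal_crown_top; have idR := ideal_crown_bottom.
have sqK k : k \in K -> br b (br b k) \in R.
  move=> Kk; rewrite -KcapC memv_cap !saK // abN // ideal_br //.
split=> [|Rx]; first exact: sqK.
have : x \in (K + C)%VS by rewrite KC memvf.
case/memv_addP=> k Kk [c Cc eqx]; move: Rx; rewrite eqx !brDr rpredDl ?(sqK _ Kk) // => Rc.
by rewrite rpredD // (subvP sRK) //; apply: (injb) => //; apply: (injb) => //; apply: idC.
Qed.

Lemma crown_injective_ex : ~ (fullv <= C)%VS ->
  exists N b, [/\ ideal br N, forall y z, y \in N -> z \in N -> br y z \in C,
    (C <= N)%VS, b \in N & injective_on_factor C R b].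
Proof.
move=> nC; have idC := ideal_crown_top; have [chAB _ _ _] := crownCR.
have exk : exists k, (derived br k <= C)%VS.
  by have [k Dk] := Hsolv; exists k; rewrite Dk sub0v.
(* The least index is a successor, as term 0 is the whole algebra; the preceding term is not in [C],
   but its derived algebra is. *)
case: (ex_minnP exk) => -[|k] sDC minD; first by case: nC.
have idN : ideal br (derived br k + C)%VS by apply: ideal_add => //; apply: ideal_derived.
have abN y z : y \in (derived br k + C)%VS -> z \in (derived br k + C)%VS -> br y z \in C.
  move=> /memv_addP[d Dd [c Cc ->]] /memv_addP[d' Dd' [c' Cc' ->]].
  rewrite brDr rpredD ?(idC _ _ Cc') // brDl rpredD ?(ideal_br _ idC Cc) //.
  by apply: (subvP sDC); apply: mem_brv.
have [|b Nb injb] := injective_on_chief_factor chAB crown_cent idN abN.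
  by rewrite subv_add => /andP[/minD]; rewrite ltnn.
exists (derived br k + C)%VS, b; split=> //; first exact: addvSr.
exact: crown_injective.
Qed.

Lemma injective_mod_crown b c : c \in C ->
  injective_on_factor C R b -> injective_on_factor C R (b - c).
Proof.
move=> Cc injb x Cx; rewrite brDl brNl rpredDr; first exact: injb.
by rewrite rpredN crown_abelian.
Qed.

Lemma one_ad_conj b1 b2 : b2 - b1 \in C -> injective_on_factor C R b1 ->
  exists2 a, a \in C & b1 + br a b1 - b2 \in R.
Proof.
have idC := ideal_crown_top; have idR := ideal_crown_bottom.
move=> Cd injb; have [f fE] := ad_lfun_ex b1.
have subf I : ideal br I -> (f @: I <= I)%VS.
  by move=> idI; apply/subvP=> _ /memv_imgP[x Ix ->]; rewrite fE idI.
have surj : (f @: C + R)%VS = C.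
  apply: lfun_quo_surj; rewrite ?crown_sub ?subf // => x; rewrite fE; exact: injb.
have: b2 - b1 \in (f @: C + R)%VS by rewrite surj.
case/memv_addP=> _ /memv_imgP[c Cc ->] [r Rr eqd].
(* With [c] solving [br b1 c = b2 - b1] modulo [R], the sign turns [br b1 c] into [br a b1]. *)
exists (- c); first by rewrite rpredN.
rewrite brNl -brC -fE addrAC.
have -> : b1 - b2 = - (f c + r) by rewrite -eqd opprB.
by rewrite opprD addrC addNKr rpredN.
Qed.

Lemma one_ad_mod_br a u v u' v' : a \in C ->
    u + br a u - u' \in R -> v + br a v - v' \in R ->
  br u v + br a (br u v) - br u' v' \in R.
Proof.
move=> Ca Ru Rv; have idR := ideal_crown_bottom.
have := one_ad_br u v Ca.
move: (u + br a u) (v + br a v) Ru Rv => p q Rp Rq Rpq.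
rewrite -(subrKA (br p q)) rpredD //; first by rewrite -opprB rpredN.
rewrite -(subrKA (br u' q)) rpredD //; first by rewrite -brNl -brDl ideal_br.
by rewrite -brNr -brDr idR.
Qed.

Lemma crown_complement_conj K1 K2 :
    complement_mod br R C K1 -> complement_mod br R C K2 ->
  exists2 a, a \in C & one_ad_aut_mod br R a /\ one_ad_maps_mod br R a K1 K2.
Proof.
move=> compK1 compK2; have idC := ideal_crown_top; have idR := ideal_crown_bottom.
have [[_ sRK1 K1C K1capC] [_ sRK2 K2C K2capC]] := (compK1, compK2).
(* If [C] is everything, both complements equal [R] and [a = 0] works. *)
case: (classic (fullv <= C)%VS) => [fullC | nfullC].
  have K1R x : (x \in K1) = (x \in R).
    by rewrite -K1capC memv_cap (subvP fullC) ?memvf ?andbT.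
  have K2R x : (x \in K2) = (x \in R).
    by rewrite -K2capC memv_cap (subvP fullC) ?memvf ?andbT.
  exists 0; rewrite ?mem0v //; split=> [|y]; first by apply: one_ad_aut; apply: mem0v.
  rewrite K2R; split=> [Ry | [x]].
    by exists 0; rewrite ?mem0v // br0r addr0 subr0.
  by rewrite K1R br0l addr0 => Rx Ryx; rewrite -(subrK x y) rpredD.
have [N [b [idN abN sCN Nb injb]]] := crown_injective_ex nfullC.
have complE K : complement_mod br R C K -> exists2 c, c \in C &
    forall x, x \in K <-> br (b - c) (br (b - c) x) \in R.
  move=> compK; have [_ _ KC _] := compK.
  have /memv_addP[k Kk [c Cc eqb]] : b \in (K + C)%VS by rewrite KC memvf.
  exists c => // x; apply: (mem_crown_complement _ idN abN _ _ compK).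
  - by rewrite rpredB // (subvP sCN).
  - exact: injective_mod_crown.
  - by rewrite eqb addrK.
have [c1 Cc1 K1E] := complE _ compK1; have [c2 Cc2 K2E] := complE _ compK2.
have [|a Ca Rb] := @one_ad_conj (b - c1) (b - c2) _ (injective_mod_crown Cc1 injb).
  by rewrite opprB addrC addrA subrK rpredB.
exists a => //; have autR := one_ad_aut Ca; have [phiR phisurj _] := autR.
split=> // y.
have K12 x : x + br a x - y \in R -> x \in K1 <-> y \in K2.
  move=> Rxy; rewrite K1E K2E.
  (* Modulo [R], [1 + ad a] carries the double bracket of [x] with [b - c1] to that of [y] with
     [b - c2]. *)
  have Rsq := one_ad_mod_br Ca Rb (one_ad_mod_br Ca Rb Rxy).
  rewrite -phiR; split=> Rw.
    by move: Rsq; rewrite rpredBl.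
  by move: Rsq; rewrite rpredBr.
split=> [K2y | [x K1x Ryx]].
  have [x Rxy] := phisurj y; exists x; first exact: (proj2 (K12 x Rxy)).
  by rewrite -opprB rpredN.
by apply: (proj1 (K12 x _)) => //; rewrite -opprB rpredN.
Qed.

End Crown.

End LieAlgebra.

Theorem theorem3p5 (F : fieldType) (L : vectType F) (br : L -> L -> L)
  (Hbr : lie_bracket br) (Hsolv : solvable_lie br)
  (A B C R : {vspace L}) (Hcrown : crown br A B C R) :
  (exists K : {vspace L}, complement_mod br R C K) /\
  (forall K1 K2 : {vspace L}, complement_mod br R C K1 -> complement_mod br R C K2 ->
     exists2 a : L, a \in C & one_ad_aut_mod br R a /\ one_ad_maps_mod br R a K1 K2).
Proof.
split; first exact: crown_complement_ex Hcrown.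
by move=> K1 K2; apply: crown_complement_conj Hcrown K1 K2.
Qed.
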